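(* Let $G$ be a finite, simple, connected, non-bipartite graph and let $\Gamma=\{g_1,g_2,\dots,g_k\}$ be a finite abelian group (written additively), where $k=|\Gamma|$. Let $c_0$ be any vertex coloring of $G$ with colors from $\Gamma$, with color classes $U_1,\dots,U_k$, where $U_i=\{v\in V(G): c_0(v)=g_i\}$ and $n_i=|U_i|$ for $1\le i\le k$. If there exists an element $h\in\Gamma$ such that $n_1g_1+\dots+n_kg_k=2h$, then there is an edge-weighting $w:E(G)\to\Gamma$ such that the induced vertex coloring equals $c_0$, i.e. $\sum_{e\ni v} w(e)=c_0(v)$ for every $v\in V(G)$.
   Context: For an edge-weighting $w:E(G)\to\Gamma$, the induced vertex coloring assigns to each vertex $v$ the sum (in $\Gamma$) of the weights of the edges incident to $v$. The coloring $c_0$ need not be proper. *)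

(* Defs.v *)
From HB Require Import structures.
From mathcomp Require Import all_boot all_order all_algebra.

Set Implicit Arguments.
Unset Strict Implicit.
Unset Printing Implicit Defensive.

Import GRing.Theory.
Local Open Scope ring_scope.

Record sgraph := SGraph {
  vertex :> finType;
  adj : rel vertex;
  adj_sym : symmetric adj;
  adj_irrefl : irreflexive adj
}.

Definition edges (G : sgraph) : {set {set G}} :=
  [set f : {set G} | [exists x, exists y, adj x y && (f == [set x; y])]].

Definition edge (G : sgraph) : finType := {f : {set G} | f \in edges G}.

Definition connected (G : sgraph) : Prop :=
  (0 < #|G|)%N /\ forall x y : G, connect (@adj G) x y.

(* The two parts are A and its complement; either may be empty. *)
Definition bipartite (G : sgraph) : Prop :=
  exists A : {set G}, forall x y : G, adj x y -> (x \in A) != (y \in A).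

Definition induced_coloring (G : sgraph) (Gam : finZmodType)
    (w : edge G -> Gam) (v : G) : Gam :=
  \sum_(f : edge G | v \in val f) w f.

Definition color_class (G : sgraph) (Gam : finZmodType)
    (c : G -> Gam) (a : Gam) : {set G} :=
  [set v | c v == a].

(* Main.v *)
Require Import Defs.
From HB Require Import structures.
From mathcomp Require Import all_boot all_order all_algebra.

Set Implicit Arguments.
Unset Strict Implicit.
Unset Printing Implicit Defensive.

Import GRing.Theory.
Local Open Scope ring_scope.

(** The realizable colorings form a subgroup of [G -> Gam].  Alternating the
    weights [a, -a, a, ...] along a walk from [x] to [y] realizes the coloring
    with value [a] at [x], value [a] (odd walk) or [-a] (even walk) at [y], and
    [0] elsewhere.  Fix a vertex [x0].  Since [G] is connected and not bipartite
    it has an odd closed walk at [x0], so every vertex is joined to [x0] by an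
    even walk.  The even walks move all the colors of [c0] onto [x0], where the
    total [2h] is realized by the odd closed walk with weights [h, -h, ...]. *)

Section Realizability.

Variables (G : sgraph) (Gam : finZmodType).
Implicit Types (x y z v : G) (a : Gam) (b c : bool).

(** Finite functions make this decidable, so that [linked] below is boolean and can define a set of
    vertices. *)
Definition realizable (col : {ffun G -> Gam}) : bool :=
  [exists w : {ffun edge G -> Gam}, [forall v, induced_coloring w v == col v]].

Lemma realizableP (col : {ffun G -> Gam}) :
  reflect (exists w : edge G -> Gam, forall v, induced_coloring w v = col v)
          (realizable col).
Proof.
apply: (iffP existsP) => [[w /'forall_eqP wE]|[w wE]]; first by exists w.
exists (finfun w); apply/'forall_eqP => v; rewrite -wE.
by apply: eq_bigr => f _; rewrite ffunE.
Qed.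

Lemma realizable0 : realizable 0.
Proof.
by apply/realizableP; exists (fun=> 0) => v; rewrite ffunE; apply: big1.
Qed.

Lemma realizableD (col1 col2 : {ffun G -> Gam}) :
  realizable col1 -> realizable col2 -> realizable (col1 + col2).
Proof.
move=> /realizableP[w1 w1E] /realizableP[w2 w2E]; apply/realizableP.
exists (fun f => w1 f + w2 f) => v.
by rewrite ffunE -w1E -w2E; apply: big_split.
Qed.

Definition point_coloring x a : {ffun G -> Gam} :=
  [ffun v => if v == x then a else 0].

Lemma point_coloringD x : {morph point_coloring x : a1 a2 / a1 + a2}.
Proof.
by move=> a1 a2; apply/ffunP => v; rewrite !ffunE; case: eqP; rewrite ?addr0.
Qed.

Lemma point_coloring0 x : point_coloring x 0 = 0.
Proof. by apply/ffunP => v; rewrite !ffunE if_same. Qed.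

Lemma point_coloringN x a : point_coloring x (- a) = - point_coloring x a.
Proof.
by apply/eqP; rewrite -addr_eq0 -point_coloringD addNr point_coloring0.
Qed.

Lemma sum_point_coloring (col : {ffun G -> Gam}) :
  \sum_v point_coloring v (col v) = col.
Proof.
apply/ffunP => u; rewrite sum_ffunE (bigD1 u) //= ffunE eqxx big1 ?addr0 //.
by move=> v; rewrite ffunE eq_sym => /negbTE->.
Qed.

(* The coloring contributed by a walk from [x] to [y], odd iff [b]. *)
Definition walk_coloring b x y a : {ffun G -> Gam} :=
  point_coloring x a + point_coloring y (if b then a else - a).

Definition linked b x y : bool :=
  [forall a, realizable (walk_coloring b x y a)].

Lemma linked_refl x : linked false x x.
Proof.
apply/forallP => a.
by rewrite /walk_coloring point_coloringN subrr realizable0.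
Qed.

Lemma linked_trans b c x y z :
  linked b x y -> linked c y z -> linked (b (+) c) x z.
Proof.
move=> /forallP lxy /forallP lyz; apply/forallP => a.
(* The second walk starts with the opposite of the value that the first leaves at [y], so the two
   contributions at [y] cancel. *)
have := realizableD (lxy a) (lyz (if b then - a else a)).
rewrite /walk_coloring.
by case: b c {lxy lyz} => [] [] /=; rewrite !point_coloringN ?opprK addrA
  ?addrK ?addrNK.
Qed.

Lemma linked_sym b x y : linked b x y -> linked b y x.
Proof.
(* This starting value at [x] is the one that puts exactly [a] at [y]. *)
move=> /forallP lxy; apply/forallP => a; have := lxy (if b then a else - a).
by rewrite /walk_coloring addrC; case: b {lxy}; rewrite ?opprK.
Qed.

Lemma linked_adj x y : adj x y -> linked true x y.
Proof.
move=> xy; apply/forallP => a; apply/realizableP.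
have xyE : [set x; y] \in edges G.
  rewrite inE; apply/existsP; exists x; apply/existsP; exists y.
  by rewrite xy eqxx.
have nxy : x != y by apply: contraTneq xy => ->; rewrite adj_irrefl.
pose e : edge G := Sub [set x; y] xyE.
exists (fun f => if f == e then a else 0) => v.
rewrite /induced_coloring -big_mkcondr /= !ffunE.
have [vxy|nvxy] := boolP (v \in [set x; y]).
  rewrite (big_pred1 e) => [|f /=].
    move: vxy; rewrite !inE => /orP[]/eqP->; rewrite eqxx.
      by rewrite (negbTE nxy) addr0.
    by rewrite eq_sym (negbTE nxy) add0r.
  by case: eqP => [->|]; rewrite ?andbF // andbT SubK vxy.
rewrite big_pred0 => [|f /=].
  move: nvxy; rewrite !inE negb_or => /andP[/negbTE-> /negbTE->].
  by rewrite addr0.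
by case: eqP => [->|]; rewrite ?andbF // andbT SubK (negbTE nvxy).
Qed.

Lemma linked_connect x y :
  connect (@adj G) x y -> linked false x y || linked true x y.
Proof.
case/connectP => p + ->; elim/last_ind: p => [|p z IHp] /=.
  by rewrite linked_refl.
rewrite rcons_path last_rcons => /andP[/IHp/orP[]lp /linked_adj lz].
  by rewrite (linked_trans lp lz) orbT.
by rewrite (linked_trans lp lz).
Qed.

Lemma linked_odd_loop x : connected G -> ~ bipartite G -> linked true x x.
Proof.
move=> [_ conG] nbip; apply/negPn/negP => nodd; apply: nbip.
(* Without an odd link from [x] to itself, the vertices evenly linked to [x] would form one side of
   a bipartition. An edge inside this set closes an odd loop at [x]. *)
exists [set y | linked false x y] => y z yz; rewrite !inE.
apply/negP => /eqP eq_yz.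
have [ly|nly] := boolP (linked false x y).
  have lz : linked false x z by rewrite -eq_yz.
  case/negP: nodd.
  exact: linked_trans (linked_trans ly (linked_adj yz)) (linked_sym lz).
(* For an edge outside the set, [y] is oddly linked to [x]; the edge then makes [z] evenly linked, a
   contradiction. *)
have /orP[|ly] := linked_connect (conG x y); first by rewrite (negbTE nly).
by case/negP: nly; rewrite eq_yz (linked_trans ly (linked_adj yz)).
Qed.

(** An odd link is made even by appending the odd loop at [y]. *)
Lemma linked_even x y : connected G -> ~ bipartite G -> linked false x y.
Proof.
move=> conG nbip; have /orP[//|lxy] := linked_connect (conG.2 x y).
exact: linked_trans lxy (linked_odd_loop y conG nbip).
Qed.

End Realizability.

(** Grouping the vertices by color turns the hypothesis on class sizes into one on the total of the
    coloring. *)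
Lemma sum_color_class (G : sgraph) (Gam : finZmodType) (k : nat)
    (g : 'I_k -> Gam) (col : G -> Gam) :
  bijective g -> \sum_(i < k) g i *+ #|color_class col (g i)| = \sum_v col v.
Proof.
move=> bij_g; rewrite [RHS](partition_big col predT) //= (reindex g).
  apply: eq_bigr => i _; rewrite -sumr_const.
  by apply: eq_big => v; rewrite ?inE // => /eqP->.
exact: onW_bij.
Qed.

Theorem theorem2p2 (G : sgraph) (Gam : finZmodType)
    (k : nat) (g : 'I_k -> Gam) (c0 : G -> Gam) :
  connected G ->
  ~ bipartite G ->
  bijective g ->
  (exists h : Gam, \sum_(i < k) g i *+ #|color_class c0 (g i)| = h *+ 2) ->
  exists w : edge G -> Gam, forall v : G, induced_coloring w v = c0 v.
Proof.
move=> conG nbip bij_g [h]; rewrite sum_color_class // => sum_c0.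
have /card_gt0P[x0 _] := conG.1.
suff /realizableP[w wE] : realizable (finfun c0).
  by exists w => v; rewrite wE ffunE.
(* The even links leave the opposite of the total, [- (h *+ 2)], at [x0]; the odd loop adds [h + h]
   there and cancels it. *)
have -> : finfun c0 = \sum_v walk_coloring false v x0 (c0 v)
                      + walk_coloring true x0 x0 h.
  rewrite /walk_coloring big_split /= -!point_coloringD.
  rewrite -(big_morph _ (point_coloringD x0) (point_coloring0 Gam x0)).
  rewrite sumrN sum_c0 -addrA -point_coloringD mulr2n addNr point_coloring0.
  rewrite addr0 -[LHS]sum_point_coloring.
  by apply: eq_bigr => v _; rewrite ffunE.
apply: realizableD; last exact: (forallP (linked_odd_loop Gam x0 conG nbip)).
apply: (big_ind (fun col => realizable col)) => [|col1 col2|v _].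
- exact: realizable0.
- exact: realizableD.
- exact: (forallP (linked_even Gam v x0 conG nbip)).
Qed.
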